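(* For the weighted complete unidirectional $k$-ary tree of depth $n$, the expected propagation time of randomized zero forcing (starting with the root blue) is exactly $n$. In particular, although each internal node has $k$ children, the propagation process is deterministic and terminates in $n$ rounds.
   Context: The complete unidirectional $k$-ary tree of depth $n$ is the rooted tree in which every vertex at depth less than $n$ has exactly $k$ children and all vertices at depth $n$ are leaves, with one directed edge from each internal vertex to each of its children and no other edges. ''Weighted'' means that its directed edges carry weights as in the following definition. Randomized zero forcing (RZF): $G$ is a finite directed graph with nonnegative weights $w_{uv}$ on directed edges $(u,v)$, with $w_{uv}=0$ if there is no edge from $u$ to $v$. Start with blue set $B_0=S$. Given the blue set $B_t$, each white vertex $w\notin B_t$ independently becomes blue at round $t+1$ with probability $p_t(w)=\frac{\sum_{u\in B_t}w_{uw}}{\sum_{u\in V(G)}w_{uw}}$ if the denominator is positive, and $p_t(w)=0$ otherwise; blue vertices stay blue forever. The expected propagation time is the expected value of $\tau=\min\{t: B_t=V(G)\}$ if coloring all of $G$ blue is possible, and $\infty$ otherwise. ''Deterministic'' means that each blue set $B_t$ is almost surely equal to a fixed set.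
   Formalization: The edge weights of the tree are assumed strictly positive and k at least 1: an edge of weight 0 would leave its child white forever, making the expected propagation time infinite, and for k = 0 there is no tree of positive depth. *)

(* Defs.v *)
From HB Require Import structures.
From mathcomp Require Import all_boot all_order all_algebra.
From mathcomp Require Import all_classical all_reals all_analysis.

Set Implicit Arguments.
Unset Strict Implicit.
Unset Printing Implicit Defensive.

Import Order.TTheory GRing.Theory Num.Theory.

Local Open Scope classical_set_scope.
Local Open Scope ring_scope.

Record wdigraph (R : realType) (V : finType) := WDigraph {
  edge : rel V;
  weight : V -> V -> R;
  weight_ge0 : forall u v, 0 <= weight u v;
  weight_nonedge : forall u v, ~~ edge u v -> weight u v = 0 }.

(* A directed walk from [r] is [r] followed by the sequence [p], with
   [path e r p]; its length is [size p].  A rooted tree with edges directed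
   away from the root is a digraph in which every vertex is reached from the
   root by exactly one directed walk. *)
Definition rooted_tree (V : finType) (e : rel V) (r : V) : Prop :=
  forall v : V, exists! p : seq V, path e r p /\ last r p = v.

Definition children (V : finType) (e : rel V) (v : V) : {set V} :=
  finset (e v).

(* The depth of [last r p] is the length [size p] of the walk from the root. *)
Definition complete_kary_tree (V : finType) (e : rel V) (r : V) (k n : nat) :
    Prop :=
  rooted_tree e r /\
  forall p : seq V, path e r p ->
    ((size p < n)%N -> #|children e (last r p)| = k) /\
    (size p = n -> #|children e (last r p)| = 0%N).

Section RandomizedZeroForcing.
Context {R : realType} {V : finType} (G : wdigraph R V).

Definition blue_prob (B : {set V}) (w : V) : R :=
  if 0 < \sum_(u : V) weight G u w
  then (\sum_(u in B) weight G u w) / (\sum_(u : V) weight G u w)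
  else 0.

(* Probability that the blue set goes from [B] to [B'] in one round, the white
   vertices turning blue independently of each other. *)
Definition rzf_trans (B B' : {set V}) : R :=
  if B \subset B' then
    \prod_(w | w \notin B)
      (if w \in B' then blue_prob B w else 1 - blue_prob B w)
  else 0.

Context {d : measure_display} {T : measurableType d} (P : probability T R).

Definition history (B : nat -> T -> {set V}) (t : nat) (b : nat -> {set V}) :
    set T :=
  [set x | forall s : nat, (s <= t)%N -> B s x = b s].

(* [B t x] is the blue set after [t] rounds for the outcome [x].  The last
   clause says that, conditionally on [B 0 = b 0, ..., B t = b t], the law of
   [B t.+1] is [rzf_trans (b t)]; it is multiplied out so that histories of
   probability 0 need no separate treatment. *)
Definition rzf_process (S : {set V}) (B : nat -> T -> {set V}) : Prop :=
  [/\ forall t (A : {set V}), measurable [set x | B t x = A],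
      forall x, B 0%N x = S
    & forall t (b : nat -> {set V}),
        P (history B t.+1 b) =
          (P (history B t b) * (rzf_trans (b t) (b t.+1))%:E)%E ].

(* The infimum of the empty set is [+oo]. *)
Definition prop_time (B : nat -> T -> {set V}) (x : T) : \bar R :=
  ereal_inf [set (t%:R)%:E | t in [set t : nat | B t x = finset.setT]].

Definition can_color_all (B : nat -> T -> {set V}) : Prop :=
  exists t : nat, (0 < P [set x | B t x = finset.setT])%E.

Definition expected_prop_time (B : nat -> T -> {set V}) : \bar R :=
  if `[< can_color_all B >] then (\int[P]_x prop_time B x)%E else +oo%E.

Definition deterministic (B : nat -> T -> {set V}) : Prop :=
  forall t : nat, exists A : {set V}, {ae P, forall x, B t x = A}.

End RandomizedZeroForcing.

(* Main.v *)
(** Every vertex other than the root has exactly one in-neighbour, its parent,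
    so a white vertex turns blue with probability 1 when its parent is blue and
    with probability 0 otherwise.  Almost surely the blue set after [t] rounds
    is therefore the set of vertices of depth at most [t]; it exhausts the tree
    exactly at [t = n], since [k > 0] provides a vertex of depth [n]. *)

Require Import Defs.
From HB Require Import structures.
From mathcomp Require Import all_boot all_order all_algebra.
From mathcomp Require Import all_classical all_reals all_analysis.
From mathcomp Require Import measurable_realfun.

Set Implicit Arguments.
Unset Strict Implicit.
Unset Printing Implicit Defensive.

Import Order.TTheory GRing.Theory Num.Theory.

Local Open Scope ring_scope.

Section RootedTree.
Context {V : finType} (e : rel V) (r : V).
Hypothesis e_tree : rooted_tree e r.

(** Depth at most [t], phrased by walks so that no depth function has to be chosen; uniqueness of
    walks makes the two readings agree. *)
Definition depth_le (t : nat) : {set V} :=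
  finset (fun v =>
    `[< exists p, [/\ path e r p, last r p = v & (size p <= t)%N] >]).

Lemma depth_leP (t : nat) (v : V) :
  reflect (exists p, [/\ path e r p, last r p = v & (size p <= t)%N])
          (v \in depth_le t).
Proof. by rewrite finset.inE; exact: asboolP. Qed.

Lemma walk_uniq (p q : seq V) :
  path e r p -> path e r q -> last r p = last r q -> p = q.
Proof.
move=> pp pq pq_last; have [s [_ s_uniq]] := e_tree (last r q).
by rewrite -(s_uniq p) ?(s_uniq q).
Qed.

Lemma walk_exists (v : V) : exists2 p, path e r p & last r p = v.
Proof. by have [p [[pp pv] _]] := e_tree v; exists p. Qed.

Lemma last_depth_le (t : nat) (p : seq V) :
  path e r p -> (last r p \in depth_le t) = (size p <= t)%N.
Proof.
move=> pp; apply/depth_leP/idP => [[q [pq qp]]|pt]; last by exists p.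
by rewrite (walk_uniq pq pp qp).
Qed.

Lemma depth_le_subset (t : nat) : depth_le t \subset depth_le t.+1.
Proof.
apply/fintype.subsetP => v /depth_leP[p [pp pv pt]].
by apply/depth_leP; exists p; split; rewrite ?leqW.
Qed.

Lemma depth_le0 : depth_le 0 = finset.set1 r.
Proof.
apply/setP => v; rewrite finset.inE; apply/depth_leP/eqP => [[p [_ <-]]|->].
  by rewrite leqn0 => /nilP ->.
by exists [::].
Qed.

(** The unique walk to [w] is the walk to [u] extended by [w], one step longer. As [u] is any
    in-neighbour of [w], this settles the colour of all in-neighbours at once. *)
Lemma depth_leS_parent (t : nat) (u w : V) :
  e u w -> (w \in depth_le t.+1) = (u \in depth_le t).
Proof.
move=> uw; have [p pp pu] := walk_exists u.
have pw : path e r (rcons p w) by rewrite rcons_path pp pu.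
by rewrite -{1}(last_rcons r p w) -pu !last_depth_le// size_rcons.
Qed.

Lemma parent_exists (w : V) : w != r -> exists u, e u w.
Proof.
move=> wr; have [p] := walk_exists w.
case/lastP: p => [_ rw|p x]; first by rewrite -rw eqxx in wr.
by rewrite rcons_path last_rcons => /andP[_ ex] <-; exists (last r p).
Qed.

End RootedTree.

Section CompleteTree.
Context {V : finType} (e : rel V) (r : V) (k n : nat).
Hypothesis e_complete : complete_kary_tree e r k n.

(** The first [n] steps of a longer walk would end at a leaf, yet its next vertex would be a child
    of that leaf. *)
Lemma walk_size_le (p : seq V) : path e r p -> (size p <= n)%N.
Proof.
move=> pp; rewrite leqNgt; apply/negP => np.
move: (pp); rewrite -(cat_take_drop n p) cat_path => /andP[pt].
have [_ /(_ (size_takel (ltnW np)))/eqP] := e_complete.2 _ pt.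
rewrite cards_eq0 => /eqP leaf.
case: (drop n p) (size_drop n p) => [/esym/eqP|x s _ /= /andP[ex _]].
  by rewrite subn_eq0 leqNgt np.
by have := finset.in_set0 x; rewrite -leaf finset.inE ex.
Qed.

Lemma walk_of_size (k_gt0 : (0 < k)%N) (t : nat) :
  (t <= n)%N -> exists2 p, path e r p & size p = t.
Proof.
elim: t => [_|t IH tn]; first by exists [::].
have [p pp pt] := IH (ltnW tn).
have [/(_ _)ck _] := e_complete.2 _ pp.
have /card_gt0P[x] : (0 < #|children e (last r p)|)%N by rewrite ck ?pt.
rewrite finset.inE => ex.
by exists (rcons p x); rewrite ?size_rcons ?pt// rcons_path pp.
Qed.

Lemma depth_le_setT (k_gt0 : (0 < k)%N) (t : nat) :
  (depth_le e r t == finset.setT) = (n <= t)%N.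
Proof.
have tr := e_complete.1; apply/eqP/idP => [eT|nt].
  (* A vertex of depth [n], which exists because [k > 0], forces [n <= t]. *)
  have [p pp <-] := walk_of_size k_gt0 (leqnn n).
  by rewrite -(last_depth_le tr)// eT finset.inE.
apply/setP => v; rewrite finset.in_setT; have [p pp <-] := walk_exists tr v.
by rewrite (last_depth_le tr)// (leq_trans (walk_size_le pp)).
Qed.

End CompleteTree.

Section Transition.
Context {R : realType} {V : finType} (G : wdigraph R V) (r : V).
Hypothesis G_tree : rooted_tree (edge G) r.
Hypothesis G_weighted : forall u v : V, edge G u v -> 0 < weight G u v.

(** Vertices outside [A] send weight 0 to [w], so numerator and denominator agree; the edge from [u]
    makes the denominator positive, which excludes the default value 0. *)
Lemma blue_prob_eq1 (A : {set V}) (u w : V) : edge G u w ->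
  (forall v, edge G v w -> v \in A) -> blue_prob G A w = 1.
Proof.
move=> uw inA; rewrite /blue_prob.
have -> : \sum_(v in A) weight G v w = \sum_v weight G v w.
  rewrite big_mkcond; apply: eq_bigr => v _; case: ifPn => // vA.
  by rewrite weight_nonedge//; apply: contra vA; exact: inA.
have s_gt0 : 0 < \sum_v weight G v w.
  rewrite (bigD1 u)//= ltr_pwDl ?G_weighted// sumr_ge0// => v _.
  exact: weight_ge0.
by rewrite s_gt0 divff// gt_eqF.
Qed.

Lemma blue_prob_eq0 (A : {set V}) (w : V) :
  (forall v, edge G v w -> v \notin A) -> blue_prob G A w = 0.
Proof.
move=> notA; rewrite /blue_prob [X in X / _]big1 ?mul0r ?if_same// => v vA.
by rewrite weight_nonedge//; apply: contraL vA; exact: notA.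
Qed.

(** Every factor of the product is 1: the in-neighbours of a white [w] are all blue if [w] has depth
    at most [t.+1], and all white otherwise. *)
Lemma rzf_trans_depth_le (t : nat) :
  rzf_trans G (depth_le (edge G) r t) (depth_le (edge G) r t.+1) = 1.
Proof.
rewrite /rzf_trans depth_le_subset big1// => w wt.
(* The root is blue at every [t], so a white vertex has a parent. *)
have wr : w != r.
  by apply: contraNneq wt => ->; apply/depth_leP; exists [::].
have [u uw] := parent_exists G_tree wr.
case: ifPn => wt1.
  apply: blue_prob_eq1 uw _ => v vw.
  by rewrite -(depth_leS_parent G_tree t vw).
rewrite blue_prob_eq0 ?subr0// => v vw.
by rewrite -(depth_leS_parent G_tree t vw).
Qed.

End Transition.

Section Process.
Context {R : realType} {V : finType} {d : measure_display}
  {T : measurableType d}.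
Variable B : nat -> T -> {set V}.
Hypothesis mB : forall t (A : {set V}), measurable [set x | B t x = A]%classic.

Lemma measurable_history (t : nat) (b : nat -> {set V}) :
  measurable (history B t b).
Proof.
have -> : history B t b =
    (\bigcap_(s in [set s | (s <= t)%N]) [set x | B s x = b s])%classic by [].
by apply: bigcap_measurable => [|s _]; [exists 0%N|exact: mB].
Qed.

(** Open lower rays generate the sigma-algebra, and the infimum is below [y] exactly when some
    [t < y] has a fully blue set: a countable union of events. *)
Lemma measurable_prop_time :
  measurable_fun [set: T]%classic (prop_time (R := R) B).
Proof.
apply: (measurability _ (ErealGenInftyO.measurableE R)) => _ [_ [y ->] <-].
rewrite setTI.
have -> : (prop_time (R := R) B @^-1` `]-oo, y%:E[ =
    \bigcup_(t in [set t | (t%:R)%:E < y%:E]%E) [set x | B t x = finset.setT])%classic.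
  apply/seteqP; split => x /=.
    rewrite in_itv/= => /ereal_inf_lt[_ [t Bt <-] ty].
    by exists t.
  move=> [t ty Bt]; rewrite in_itv/=; apply: le_lt_trans ty.
  by apply: ereal_inf_lbound; exists t.
by apply: bigcup_measurable => t _; exact: mB.
Qed.

Lemma prop_time_ge0 (x : T) : (0 <= prop_time (R := R) B x)%E.
Proof. by apply: le_ereal_inf_tmp => _ [t _ <-]; rewrite lee_fin. Qed.

Lemma prop_time_eq (n : nat) (x : T) : B n x = finset.setT ->
  (forall t, (t < n)%N -> B t x <> finset.setT) ->
  prop_time (R := R) B x = (n%:R)%:E.
Proof.
move=> Bn Blt; apply/eqP; rewrite eq_le; apply/andP; split.
  by apply: ereal_inf_lbound; exists n.
apply: le_ereal_inf_tmp => _ [t Bt <-]; rewrite lee_fin ler_nat leqNgt.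
by apply/negP => /Blt.
Qed.

Variable P : probability T R.

Lemma history_ae (t : nat) (b : nat -> {set V}) :
  P (history B t b) = 1%E -> {ae P, forall x, history B t b x}.
Proof.
move=> P1; exists (~` history B t b)%classic; split=> //.
  exact: measurableC (measurable_history t b).
by rewrite probability_setC ?P1 ?subee//; exact: measurable_history.
Qed.

Lemma expected_prop_time_eq (n : nat) :
  {ae P, forall x, prop_time (R := R) B x = (n%:R)%:E} ->
  can_color_all P B -> expected_prop_time P B = (n%:R)%:E.
Proof.
move=> Bn can; rewrite /expected_prop_time asboolT//.
rewrite (ge0_ae_eq_integral (g := cst (n%:R)%:E))//.
- by rewrite integral_cst// [X in (_ * X)%E]probability_setT mule1.
- exact: measurable_prop_time.
- by move=> x _; exact: prop_time_ge0.
- by move=> x _; rewrite lee_fin.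
- by apply: filterS Bn => x Bx _.
Qed.

End Process.

(** Whole histories are tracked because the process law is stated for them; each round multiplies
    the probability by a transition probability equal to 1. *)
Lemma history_depth_le (R : realType) (V : finType) (G : wdigraph R V) (r : V)
    (G_tree : rooted_tree (edge G) r)
    (G_weighted : forall u v : V, edge G u v -> 0 < weight G u v)
    (d : measure_display) (T : measurableType d) (P : probability T R)
    (B : nat -> T -> {set V}) (B_rzf : rzf_process G P (finset.set1 r) B)
    (t : nat) :
  P (history B t (depth_le (edge G) r)) = 1%E.
Proof.
have [_ B0 Bstep] := B_rzf; elim: t => [|t IH].
  rewrite -(probability_setT P); congr (P _); apply/seteqP; split => // x _ s.
  by rewrite leqn0 => /eqP ->; rewrite B0 depth_le0.
by rewrite Bstep IH rzf_trans_depth_le// mule1.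
Qed.

Theorem corollary3p3 (R : realType) (V : finType) (G : wdigraph R V) (r : V)
    (k n : nat) (k_gt0 : (0 < k)%N)
    (G_tree : complete_kary_tree (edge G) r k n)
    (G_weighted : forall u v : V, edge G u v -> 0 < weight G u v)
    (d : measure_display) (T : measurableType d) (P : probability T R)
    (B : nat -> T -> {set V})
    (B_rzf : rzf_process G P (finset.set1 r) B) :
  [/\ expected_prop_time P B = (n%:R)%:E,
      deterministic P B
    & {ae P, forall x, prop_time (R := R) B x = (n%:R)%:E}].
Proof.
have [mB _ _] := B_rzf.
have P1 := history_depth_le G_tree.1 G_weighted B_rzf.
have Bn : {ae P, forall x, prop_time (R := R) B x = (n%:R)%:E}.
  (* The history up to round [n] fixes all earlier blue sets too, so it shows both that round [n]
     completes the tree and that no earlier round does. *)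
  apply: filterS (history_ae mB (P1 n)) => x Bx; apply: prop_time_eq.
    by rewrite Bx//; apply/eqP; rewrite (depth_le_setT G_tree).
  move=> t tn; rewrite Bx ?(ltnW tn)//; apply/eqP.
  by rewrite (depth_le_setT G_tree)// -ltnNge.
split=> //.
- apply: expected_prop_time_eq => //; exists n.
  (* The history event has probability 1 and lies inside the event that all is blue at round [n]. *)
  apply: (@lt_le_trans _ _ (P (history B n (depth_le (edge G) r)))).
    by rewrite P1 lte01.
  apply: le_measure; rewrite ?inE; [exact: measurable_history|exact: mB|].
  move=> x Bx /=; rewrite Bx//; apply/eqP.
  by rewrite (depth_le_setT G_tree).
- move=> t; exists (depth_le (edge G) r t).
  by apply: filterS (history_ae mB (P1 t)) => x; exact.
Qed.
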